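(* Let $p$ be an odd prime and suppose $d>3p^2$. Then the set $\{\theta_{\Lambda_{a,b}}(q) : a,b\in\mathbb{Z}\}\subset\mathbb{Z}[[q]]$ spans a $\mathbb{Q}$-vector space of dimension $\frac{(p+1)^2}{4}$ in $\mathbb{Q}[[q]]$. Hence, for $d>3p^2$ and integers $a,b,m,n$, one has $\theta_{\Lambda_{m,n}}(q)=\theta_{\Lambda_{a,b}}(q)$ if and only if $(m,n)$ is congruent modulo $p$ (componentwise) to one of $(a,b)$, $(-a-b,b)$, $(-a,-b)$, $(a+b,-b)$.
   Context: Let $d$ be a positive integer such that $\ell=4d-1$ is square-free (so $\ell\equiv 3\pmod 4$). Let $K=\mathbb{Q}(\sqrt{-\ell})$, with ring of integers $\mathcal{O}_K=\mathbb{Z}[\omega_\ell]$, where $\omega_\ell=\frac{-1+\sqrt{-\ell}}{2}$. For a prime $p$ and integers $a,b$, let $\Lambda_{a,b}$ denote the coset $a-b\omega_\ell+p\mathcal{O}_K$, with theta series $$\theta_{\Lambda_{a,b}}(q)=\sum_{m,n\in\mathbb{Z}}q^{|a+mp-(b+np)\omega_\ell|^2}=\sum_{m,n\in\mathbb{Z}}q^{Q_d(mp+a,\,np+b)},\qquad Q_d(x,y)=|x-y\omega_\ell|^2=x^2+xy+dy^2,$$ regarded as a formal power series in $q$. *)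

(* Defs.v *)
From mathcomp Require Import all_boot all_order all_algebra all_field.
From mathcomp Require Import finmap all_classical.
From mathcomp Require Import ring lra zify.

Set Implicit Arguments.
Unset Strict Implicit.
Unset Printing Implicit Defensive.

Import Order.TTheory GRing.Theory Num.Theory.

Local Open Scope classical_set_scope.
Local Open Scope ring_scope.

Section LinearAlgebra.
Variables (K : fieldType) (V : lmodType K).

Definition linear_span (S : set V) : set V :=
  [set v | exists n (c : 'I_n -> K) (s : 'I_n -> V),
     (forall i, S (s i)) /\ v = \sum_(i < n) c i *: s i].

Definition linearly_independent n (e : 'I_n -> V) : Prop :=
  forall c : 'I_n -> K, \sum_(i < n) c i *: e i = 0 -> forall i, c i = 0.

(* [W] is a subspace of [V] of finite dimension [n]; [V] itself may be
   infinite-dimensional, so [vectType] does not apply. *)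
Definition has_dim (W : set V) (n : nat) : Prop :=
  exists e : 'I_n -> V,
    linearly_independent e /\ linear_span (range e) = W.

End LinearAlgebra.

(* Formal power series in q, given by their coefficients.  The regular module
   [R^o] makes [fps R] an [R]-module for the coefficientwise operations. *)
Definition fps (R : pzRingType) := nat -> R^o.

Definition fps_rat (f : fps int) : fps rat := fun N => (f N)%:~R.


Definition squarefree (n : nat) : Prop :=
  forall k : nat, (k ^ 2 %| n)%N -> k = 1%N.

(* ell = 4d - 1; the natural-number subtraction is exact for 0 < d. *)
Definition ell (d : nat) : nat := (4 * d - 1)%N.

Definition sqrt_neg_ell (d : nat) : algC := 'i * sqrtC (ell d)%:R.

Definition omega (d : nat) : algC := (-1 + sqrt_neg_ell d) / 2.

(* The imaginary quadratic field Q(sqrt(-ell)) as a subset of [algC]. *)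
Definition quad_field (d : nat) : set algC :=
  [set z | exists x y : rat, z = ratr x + ratr y * sqrt_neg_ell d].

Definition ring_of_integers (d : nat) : set algC :=
  [set z | quad_field d z /\ z \in Aint].

Definition Lambda (d p : nat) (a b : int) : set algC :=
  [set z | exists2 u, ring_of_integers d u &
     z = a%:~R - b%:~R * omega d + p%:R * u].

(* The theta series \sum_(z in L) q^(|z|^2): its N-th coefficient counts the
   z in L with |z|^2 = N.  [fset_set] sends an infinite set to the empty one;
   [finite_Lambda_norm] shows that this case does not occur for [Lambda], and
   [Lambda_norm_nat] that no term has a non-integral exponent. *)
Definition theta (L : set algC) : fps int := fun N =>
  (#|` fset_set [set z | L z /\ `|z| ^+ 2 = N%:R] |%fset)%:Z.

Definition Qd (d : nat) (x y : int) : int := x ^+ 2 + x * y + d%:Z * y ^+ 2.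

Lemma ellE (d : nat) : (0 < d)%N -> (ell d)%:R = 4 * d%:R - 1 :> algC.
Proof. by move=> d0; rewrite /ell natrB ?natrM //; lia. Qed.

Lemma ell_gt0 (d : nat) : (0 < d)%N -> (0 < ell d)%N.
Proof. by rewrite /ell; lia. Qed.

Lemma sqrt_neg_ellK (d : nat) : (sqrt_neg_ell d) ^+ 2 = - (ell d)%:R.
Proof. by rewrite exprMn sqrCi sqrtCK mulN1r. Qed.

Lemma conj_sqrt_neg_ell (d : nat) : (sqrt_neg_ell d)^* = - sqrt_neg_ell d.
Proof.
rewrite rmorphM /= conjCi mulNr conj_Creal //.
by rewrite ger0_real // sqrtC_ge0 ler0n.
Qed.

Lemma norm_quad (d : nat) (x y : algC) : x \is Num.real -> y \is Num.real ->
  `|x + y * sqrt_neg_ell d| ^+ 2 = x ^+ 2 + (ell d)%:R * y ^+ 2.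
Proof.
move=> xr yr; rewrite normCK rmorphD rmorphM /= conj_sqrt_neg_ell.
by rewrite !conj_Creal // -[(ell d)%:R]opprK -sqrt_neg_ellK; ring.
Qed.

Lemma norm_omega (d : nat) (x y : int) : (0 < d)%N ->
  `|x%:~R - y%:~R * omega d| ^+ 2 = (Qd d x y)%:~R :> algC.
Proof.
move=> d0; have -> : x%:~R - y%:~R * omega d =
  (x%:~R + y%:~R / 2) + (- (y%:~R / 2)) * sqrt_neg_ell d by rewrite /omega; field.
have yr : (y%:~R / 2 : algC) \is Num.real by rewrite rpredM ?realz ?rpredV ?realn.
rewrite norm_quad ?rpredN ?rpredD ?realz // ellE // /Qd.
by rewrite !expr2 !(rmorphD, rmorphM) /=; field.
Qed.

Lemma mem_ZomegaP (d : nat) (x y u v : int) : (0 < d)%N ->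
  x%:~R - y%:~R * omega d = u%:~R - v%:~R * omega d -> x = u /\ y = v.
Proof.
move=> d0 e.
have : (Qd d (x - u) (y - v))%:~R = 0 :> algC.
  rewrite -norm_omega //; apply/eqP; rewrite expf_eq0 normr_eq0 /=; apply/eqP.
  by rewrite !rmorphB /=; move: e => /eqP; rewrite -subr_eq0 => /eqP <-; ring.
move/eqP; rewrite intr_eq0 /Qd => /eqP.
move: d0; move: (x - u) (y - v) (subr0_eq (V:=int) (x:=x) (y:=u)) (subr0_eq (V:=int) (x:=y) (y:=v)).
move=> X Y hX hY d0 h.
have h1 : (2 * X + Y) ^+ 2 + (4 * d%:Z - 1) * Y ^+ 2 = 0.
  by apply: etrans (_ : 4 * 0 = 0); rewrite // -h; ring.
have h2 : 0 <= (2 * X + Y) ^+ 2 by exact: sqr_ge0.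
have h3 : Y ^+ 2 <= (4 * d%:Z - 1) * Y ^+ 2.
  by rewrite ler_peMl ?sqr_ge0 //; lia.
have h4 : Y ^+ 2 = 0 by have := sqr_ge0 Y; lia.
have Y0 : Y = 0 by apply/eqP; rewrite -sqrf_eq0 h4.
have X0 : X = 0 by apply/eqP; move: h; rewrite Y0 mulr0 expr0n /= mulr0 !addr0 => /eqP; rewrite sqrf_eq0.
by split; [apply: hX | apply: hY].
Qed.

Lemma squarefree_rat (l : nat) (q : rat) : squarefree l ->
  l%:R * q ^+ 2 \is a Num.int -> q \is a Num.int.
Proof.
move=> sf /intrP[k]; rewrite -[q]divq_num_den.
have dn0 : (denq q)%:~R != 0 :> rat by rewrite intr_eq0 denq_neq0.
move=> e; have {e} : l%:Z * numq q ^+ 2 = k * denq q ^+ 2.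
  apply: (intr_inj (R := rat)); rewrite !expr2 !rmorphM /= -!expr2.
  by rewrite -e; field.
move/(congr1 absz); rewrite /= !abszM /= !mulnn => e.
have /sf d1 : (`|denq q| ^ 2 %| l)%N.
  rewrite -(@Gauss_dvdl _ _ (`|numq q| ^ 2)%N); first by rewrite e dvdn_mull.
  by rewrite coprimeXl ?coprimeXr // coprime_sym coprime_num_den.
have -> : denq q = 1 by move: (denq_gt0 q) d1; lia.
by rewrite divr1 intr_int.
Qed.

Lemma ring_of_integersE (d : nat) : (0 < d)%N -> squarefree (ell d) ->
  ring_of_integers d =
  [set z | exists x y : int, z = x%:~R + y%:~R * omega d].
Proof.
move=> d0 sf; apply/seteqP; split=> z /=.
  case=> -[x [y ->]] zA.
  set s := sqrt_neg_ell d in zA *.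
  have zcA : ratr x - ratr y * s \in Aint.
    have -> : ratr x - ratr y * s = (ratr x + ratr y * s)^*.
      rewrite rmorphD (rmorphM _ (ratr y)) /= (conj_sqrt_neg_ell d).
      by rewrite !conj_Crat ?Crat_rat // mulrN.
    by rewrite Aint_aut.
  have : (ratr (2 * x) : algC) \in Num.int.
    apply: Cint_rat_Aint; first exact: Crat_rat.
    have -> : ratr (2 * x) = (ratr x + ratr y * s) + (ratr x - ratr y * s).
      by rewrite rmorphM /= ratr_nat; ring.
    exact: rpredD.
  rewrite Cint_rat => /intrP[u xu].
  have : (ratr (x ^+ 2 + (ell d)%:R * y ^+ 2) : algC) \in Num.int.
    apply: Cint_rat_Aint; first exact: Crat_rat.
    have -> : ratr (x ^+ 2 + (ell d)%:R * y ^+ 2) =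
       (ratr x + ratr y * s) * (ratr x - ratr y * s).
      rewrite !expr2 !(rmorphD, rmorphM) /= ratr_nat.
      by rewrite -[(ell d)%:R]opprK -sqrt_neg_ellK -/s; ring.
    exact: rpredM.
  rewrite Cint_rat => /intrP[w xyw].
  have : 2 * y \is a Num.int.
    apply: (squarefree_rat sf).
    have -> : (ell d)%:R * (2 * y) ^+ 2 = 4 * w%:~R - u%:~R ^+ 2.
      by rewrite -xyw -xu; ring.
    by rewrite rpredB ?rpredM ?rpredX ?intr_int ?rpred_nat.
  case/intrP=> v yv.
  have uv : u ^+ 2 + (4 * d%:Z - 1) * v ^+ 2 = 4 * w.
    apply: (intr_inj (R := rat)).
    rewrite !expr2 !(rmorphD, rmorphB, rmorphM) /= -xyw -yv -xu.
    by rewrite /ell natrB ?natrM; [ring | lia].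
  have [t ut] : exists t, u + v = 2 * t.
    exists ((u + v) %/ 2)%Z; nia.
  exists t, v.
  have -> : x = u%:~R / 2 by rewrite -xu; field.
  have -> : y = v%:~R / 2 by rewrite -yv; field.
  have -> : u = 2 * t - v by rewrite -ut; ring.
  rewrite !fmorph_div /= !ratr_int ratr_nat /omega -/s.
  by rewrite rmorphB rmorphM /=; field.
case=> x [y ->]; split.
  exists (x%:~R - y%:~R / 2), (y%:~R / 2).
  rewrite rmorphB !fmorph_div /= !ratr_int ratr_nat /omega.
  by field.
apply: rpredD; first exact: Aint_int.
apply: rpredM; first exact: Aint_int.
apply: (@root_monic_Aint ('X^2 + 'X + d%:R%:P)).
- rewrite /root !hornerE /omega.
  have -> : d%:R = ((ell d)%:R + 1) / 4 :> algC by rewrite ellE //; field.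
  by rewrite -[(ell d)%:R]opprK -sqrt_neg_ellK; apply/eqP; field.
- rewrite monicE -addrA lead_coefDl ?lead_coefXn //.
  rewrite size_polyXn size_polyDl ?size_polyX //.
  by rewrite (leq_ltn_trans (size_polyC_leq1 _)).
apply/polyOverP => i; rewrite !coefD coefXn coefX coefC.
by rewrite !rpredD ?rpred_nat //; case: ifP; rewrite ?rpred_nat ?rpred0.
Qed.

Lemma finite_int_ball (B : nat) : finite_set [set x : int | (`|x| <= B)%N].
Proof.
apply: (@sub_finite_set _ _ ((fun n : nat => n%:Z - B%:Z) @` `I_(2 * B).+1)).
  by move=> x /= hx; exists (absz (x + B%:Z)); lia.
by apply: finite_image; exact: finite_II.
Qed.

Lemma Qd_ge (d : nat) (x y : int) : (0 < d)%N ->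
  y ^+ 2 <= 4 * Qd d x y /\ x ^+ 2 <= 4 * d%:Z * Qd d x y.
Proof.
move=> d0; rewrite /Qd; split.
  have h1 : 0 <= (2 * x + y) ^+ 2 by exact: sqr_ge0.
  have h2 : y ^+ 2 <= (4 * d%:Z - 1) * y ^+ 2.
    by rewrite ler_peMl ?sqr_ge0 //; lia.
  have -> : 4 * (x ^+ 2 + x * y + d%:Z * y ^+ 2) =
    (2 * x + y) ^+ 2 + (4 * d%:Z - 1) * y ^+ 2 by ring.
  by lia.
have h1 : 0 <= (2 * d%:Z * y + x) ^+ 2 by exact: sqr_ge0.
have h2 : x ^+ 2 <= (4 * d%:Z - 1) * x ^+ 2.
  by rewrite ler_peMl ?sqr_ge0 //; lia.
have -> : 4 * d%:Z * (x ^+ 2 + x * y + d%:Z * y ^+ 2) =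
  (2 * d%:Z * y + x) ^+ 2 + (4 * d%:Z - 1) * x ^+ 2 by ring.
by lia.
Qed.

Lemma finite_Qd (d p : nat) (a b N : int) : (0 < d)%N -> (0 < p)%N ->
  finite_set [set mn : int * int |
    Qd d (a + mn.1 * p%:Z) (b + mn.2 * p%:Z) = N].
Proof.
move=> d0 p0; set B := (absz (4 * d%:Z * N)%R + absz a + absz b)%N.
apply: sub_finite_set (finite_setX (finite_int_ball B) (finite_int_ball B)).
have sq_bound (c m M : int) : (c + m * p%:Z) ^+ 2 <= M ->
    (`|m| <= `|M| + `|c|)%N.
  move=> h; have h1 : (absz (c + m * p%:Z)%R <= absz M)%N.
    by move: h; rewrite expr2; nia.
  by nia.
move=> [m n] /= e; have [hy hx] := Qd_ge (a + m * p%:Z) (b + n * p%:Z) d0.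
rewrite e in hx hy; move/sq_bound : hx; move/sq_bound : hy => hy hx.
by split; rewrite /= /B; nia.
Qed.

Lemma LambdaE (d p : nat) (a b : int) : (0 < d)%N -> squarefree (ell d) ->
  Lambda d p a b =
  (fun mn : int * int => (a + mn.1 * p%:Z)%:~R -
     (b + mn.2 * p%:Z)%:~R * omega d) @` setT.
Proof.
move=> d0 sf; rewrite /Lambda ring_of_integersE //; apply/seteqP; split=> z /=.
  move=> [u [x [y ->]] ->]; exists (x, - y) => //=.
  by rewrite !(rmorphD, rmorphM, rmorphN) /=; ring.
move=> [[m n] _ <-] /=; exists (m%:~R - n%:~R * omega d).
  by exists m, (- n); rewrite rmorphN /=; ring.
by rewrite !(rmorphD, rmorphM) /=; ring.
Qed.

Lemma Lambda_norm_nat (d p : nat) (a b : int) (z : algC) :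
  (0 < d)%N -> squarefree (ell d) -> Lambda d p a b z ->
  exists N : nat, `|z| ^+ 2 = N%:R.
Proof.
move=> d0 sf; rewrite LambdaE // => -[[m n] _ <-] /=; rewrite norm_omega //.
set x := _ + _; set y := _ + _; exists `|Qd d x y|%N.
have := (Qd_ge x y d0).1; have := sqr_ge0 y; case: (Qd d x y) => //; lia.
Qed.

Lemma Lambda_normE (d p : nat) (a b : int) (N : nat) :
  (0 < d)%N -> squarefree (ell d) ->
  [set z | Lambda d p a b z /\ `|z| ^+ 2 = N%:R] =
  (fun mn : int * int => (a + mn.1 * p%:Z)%:~R -
     (b + mn.2 * p%:Z)%:~R * omega d) @`
  [set mn | Qd d (a + mn.1 * p%:Z) (b + mn.2 * p%:Z) = N%:Z].
Proof.
move=> d0 sf; rewrite LambdaE //; apply/seteqP; split=> z /=.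
  move=> [[mn _ <-]]; rewrite norm_omega // => e; exists mn => //.
  exact: (intr_inj (R := algC)).
by move=> [mn e <-]; split; [exists mn | rewrite norm_omega // e].
Qed.

Lemma finite_Lambda_norm (d p : nat) (a b : int) (N : nat) :
  (0 < d)%N -> squarefree (ell d) -> (0 < p)%N ->
  finite_set [set z | Lambda d p a b z /\ `|z| ^+ 2 = N%:R].
Proof.
by move=> d0 sf p0; rewrite Lambda_normE //; exact/finite_image/finite_Qd.
Qed.

Lemma theta_LambdaE (d p : nat) (a b : int) (N : nat) :
  (0 < d)%N -> squarefree (ell d) -> (0 < p)%N ->
  theta (Lambda d p a b) N =
  (#|` fset_set [set mn : int * int |
     Qd d (a + mn.1 * p%:Z) (b + mn.2 * p%:Z) = N%:Z] |%fset)%:Z.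
Proof.
move=> d0 sf p0; rewrite /theta Lambda_normE //.
rewrite fset_set_image; last exact: finite_Qd.
rewrite card_imfset //=.
move=> [m n] [m' n'] /= /(mem_ZomegaP d0) [em en].
have p1 : p%:Z != 0 by rewrite eqz_nat -lt0n.
by congr (_, _); apply: (mulIf p1); [apply: (addrI a) | apply: (addrI b)].
Qed.

(* Main.v *)
(* Completing the square, 4 Q_d(x, y) = (2x + y)^2 + ell y^2, so the classes
   (a, b) mod p related by the four symmetries are those sharing the residues
   of (2a + b)^2 and b^2.  Each class has exactly one representative (x, y) with
   0 <= y <= (p-1)/2 and 0 <= 2x + y <= p.  Let N be the value of Q_d there.
   Since p^2 < ell, any vector (u, v) with Q_d(u, v) = N has |v| <= y; if
   |v| = y it lies in the same class, and otherwise its class has a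
   representative with smaller second coordinate |v|.  Ordering classes by y,
   the matrix of the coefficients of the theta series at these exponents is
   triangular with nonzero diagonal. *)
Require Import Defs.
From mathcomp Require Import all_boot all_order all_algebra all_field.
From mathcomp Require Import finmap all_classical.
From mathcomp Require Import ring zify.

Set Implicit Arguments.
Unset Strict Implicit.
Unset Printing Implicit Defensive.

Import Order.TTheory GRing.Theory Num.Theory.

Local Open Scope classical_set_scope.
Local Open Scope ring_scope.

(** * Linear independence from triangular coefficients *)

Lemma triangular_independent (K : fieldType) n (e : 'I_n -> fps K)
    (N : 'I_n -> nat) :
  (forall i, e i (N i) != 0) ->
  (forall i j : 'I_n, (i < j)%N -> e j (N i) = 0) ->
  linearly_independent e.
Proof.
move=> e_neq0 e_eq0 c c0 i.
(* Strong induction on the index: in the coefficient of the relation at [N i], terms with [j < i]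
   vanish by induction and terms with [j > i] by triangularity. *)
elim/ltn_ind: {i}(i : nat) {-2}i (erefl (i : nat)) => k IH i ik.
have scaleE j l : (c j *: e j) (N l) = c j * e j (N l) by [].
have : (\sum_(j < n) c j *: e j) (N i) = 0 by rewrite c0.
rewrite fct_sumE (bigD1 i) //= big1 => [|j ji]; rewrite scaleE.
  by move/eqP; rewrite addr0 mulf_eq0 (negbTE (e_neq0 i)) orbF => /eqP.
have [ij|ji'|/ord_inj ij] := ltngtP i j.
- by rewrite e_eq0 ?mulr0.
- by rewrite (IH j) ?mul0r // -ik.
- by rewrite ij eqxx in ji.
Qed.

(** * Congruences and the four symmetries *)

Lemma eqz_modP (p : nat) (x y : int) :
  (x = y %[mod p])%Z <-> exists k, x = y + k * p%:Z.
Proof.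
split=> [/eqP|[k ->]]; last by rewrite addrC modzMDl.
rewrite eqz_mod_dvd => /dvdzP[k xy]; exists k.
by rewrite -xy addrC subrK.
Qed.

Lemma eqz_mod_sqr (p : nat) (x y : int) : prime p ->
  (x ^+ 2 = y ^+ 2 %[mod p])%Z <-> (x = y %[mod p])%Z \/ (x = - y %[mod p])%Z.
Proof.
move=> p_prime; have E u v : (u = v %[mod p])%Z <-> (p%:Z %| u - v)%Z.
  by rewrite -eqz_mod_dvd; split=> /eqP.
rewrite !E subr_sqr opprK !dvdzE abszM /= Euclid_dvdM //.
by split=> /orP.
Qed.

(** The four symmetries are the four sign choices in 2m + n = ±(2a + b), n = ±b modulo p; as 2 is
    invertible modulo p, these two values determine m and n. *)
Lemma symmetry_classP (p : nat) (a b m n : int) : prime p -> odd p ->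
  [\/ (m = a %[mod p])%Z /\ (n = b %[mod p])%Z,
      (m = - a - b %[mod p])%Z /\ (n = b %[mod p])%Z,
      (m = - a %[mod p])%Z /\ (n = - b %[mod p])%Z |
      (m = a + b %[mod p])%Z /\ (n = - b %[mod p])%Z] <->
  ((2 * m + n) ^+ 2 = (2 * a + b) ^+ 2 %[mod p])%Z /\
  (n ^+ 2 = b ^+ 2 %[mod p])%Z.
Proof.
move=> p_prime p_odd; rewrite !eqz_mod_sqr //.
have half x y z k : 2 * x + y = 2 * z + y + k * p%:Z -> (x = z %[mod p])%Z.
  (* Here 2(x - z) = kp, and writing p = 2q + 1 gives k = 2(x - z - kq), so k is even. *)
  move=> xz; apply/eqz_modP; exists (k %/ 2)%Z.
  have [q pq] : exists q : nat, p = (2 * q + 1)%N by exists p./2; lia.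
  have [j kj] : exists j, k = 2 * j.
    exists (x - z - k * q%:Z); move: xz; rewrite pq PoszD PoszM; lia.
  by rewrite kj mulKz //; move: xz; rewrite kj; lia.
split.
  case=> -[/eqz_modP[k ->] /eqz_modP[l ->]]; split.
  - by left; apply/eqz_modP; exists (2 * k + l); ring.
  - by left; apply/eqz_modP; exists l; ring.
  - by right; apply/eqz_modP; exists (2 * k + l); ring.
  - by left; apply/eqz_modP; exists l; ring.
  - by right; apply/eqz_modP; exists (2 * k + l); ring.
  - by right; apply/eqz_modP; exists l; ring.
  - by left; apply/eqz_modP; exists (2 * k + l); ring.
  - by right; apply/eqz_modP; exists l; ring.
case=> -[] /eqz_modP[k mk] [] /eqz_modP[l nl].
- apply: Or41; split; last by apply/eqz_modP; exists l.
  by apply: (half _ n _ (k - l)); rewrite mk nl; ring.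
- apply: Or44; split; last by apply/eqz_modP; exists l.
  by apply: (half _ n _ (k - l)); rewrite mk nl; ring.
- apply: Or42; split; last by apply/eqz_modP; exists l.
  by apply: (half _ n _ (k - l)); rewrite mk nl; ring.
- apply: Or43; split; last by apply/eqz_modP; exists l.
  by apply: (half _ n _ (k - l)); rewrite mk nl; ring.
Qed.

(** * Equality and support of theta series *)

Lemma theta_eq (d p : nat) (a b a' b' : int) (f g : int * int -> int * int) :
  (0 < d)%N -> squarefree (ell d) -> (0 < p)%N ->
  cancel f g -> cancel g f ->
  (forall mn, Qd d (a' + (f mn).1 * p%:Z) (b' + (f mn).2 * p%:Z) =
              Qd d (a + mn.1 * p%:Z) (b + mn.2 * p%:Z)) ->
  theta (Lambda d p a' b') = theta (Lambda d p a b).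
Proof.
move=> d0 sf p0 fg gf Qf; apply/funext => N; rewrite !theta_LambdaE //.
have -> : [set mn : int * int |
      Qd d (a' + mn.1 * p%:Z) (b' + mn.2 * p%:Z) = N%:Z] =
    f @` [set mn | Qd d (a + mn.1 * p%:Z) (b + mn.2 * p%:Z) = N%:Z].
  apply/seteqP; split=> mn /=; last by move=> [uv <- <-]; rewrite Qf.
  by move=> h; exists (g mn); rewrite ?gf // -Qf gf.
rewrite fset_set_image; last exact: finite_Qd.
by rewrite card_imfset //; exact: can_inj fg.
Qed.

(** The symmetries are generated by z -> -z and complex conjugation, which sends (x, y) to (x + y,
    -y); both preserve the norm. The shifts by k and l below absorb the change of representative
    modulo p. *)
Lemma theta_symmetry (d p : nat) (a b m n : int) :
  (0 < d)%N -> squarefree (ell d) -> (0 < p)%N ->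
  [\/ (m = a %[mod p])%Z /\ (n = b %[mod p])%Z,
      (m = - a - b %[mod p])%Z /\ (n = b %[mod p])%Z,
      (m = - a %[mod p])%Z /\ (n = - b %[mod p])%Z |
      (m = a + b %[mod p])%Z /\ (n = - b %[mod p])%Z] ->
  theta (Lambda d p m n) = theta (Lambda d p a b).
Proof.
move=> d0 sf p0; case=> -[/eqz_modP[k ->] /eqz_modP[l ->]].
- apply: (@theta_eq d p _ _ _ _ (fun u => (u.1 - k, u.2 - l))
    (fun u => (u.1 + k, u.2 + l))) => // -[u v] /=; try by congr (_, _); ring.
  by rewrite /Qd; ring.
- apply: (@theta_eq d p _ _ _ _ (fun u => (- u.1 - u.2 - k, u.2 - l))
    (fun u => (- u.1 - u.2 - k - l, u.2 + l))) => // -[u v] /=;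
    try by congr (_, _); ring.
  by rewrite /Qd; ring.
- apply: (@theta_eq d p _ _ _ _ (fun u => (- u.1 - k, - u.2 - l))
    (fun u => (- u.1 - k, - u.2 - l))) => // -[u v] /=;
    try by congr (_, _); ring.
  by rewrite /Qd; ring.
- apply: (@theta_eq d p _ _ _ _ (fun u => (u.1 + u.2 - k, - u.2 - l))
    (fun u => (u.1 + u.2 + k + l, - u.2 - l))) => // -[u v] /=;
    try by congr (_, _); ring.
  by rewrite /Qd; ring.
Qed.

Lemma theta_neq0P (d p : nat) (a b : int) (N : nat) :
  (0 < d)%N -> squarefree (ell d) -> (0 < p)%N ->
  theta (Lambda d p a b) N <> 0 <->
  exists x y : int, [/\ (x = a %[mod p])%Z, (y = b %[mod p])%Z & Qd d x y = N%:Z].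
Proof.
move=> d0 sf p0; rewrite theta_LambdaE //.
have fin := finite_Qd a b N%:Z d0 p0.
set A := fset_set _; split=> [A0|[x [y [/eqz_modP[k xa] /eqz_modP[l yb] Qxy]]]].
  have [A0'|[[k l]]] := fset_0Vmem A; first by rewrite A0' cardfs0 in A0.
  rewrite in_fset_set // inE /= => Qkl.
  exists (a + k * p%:Z), (b + l * p%:Z); split => //; apply/eqz_modP.
    by exists k.
  by exists l.
have : (k, l) \in A by rewrite in_fset_set // inE /= -xa -yb.
by move=> klA [/cardfs0_eq A0]; rewrite A0 inE in klA.
Qed.

(** * Small representatives of squares modulo p *)

Lemma sqr_mod_half (p : nat) (c : int) : odd p ->
  exists2 r : nat, (r <= p./2)%N & (c ^+ 2 = r%:Z ^+ 2 %[mod p])%Z.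
Proof.
move=> p_odd; have p0 : p%:Z != 0 by lia.
have [r cr rp] : exists2 r : nat, (c %% p%:Z)%Z = r & (r < p)%N.
  by exists `|c %% p%:Z|%Z%N; have := modz_ge0 c p0; have := ltz_mod c p0; lia.
have e : (c ^+ 2 = r%:Z ^+ 2 %[mod p])%Z by rewrite -cr modzXm.
have [rh|rh] := leqP r p./2; first by exists r.
exists (p - r)%N; first by lia.
rewrite e; apply/eqz_modP; exists (2 * r%:Z - p%:Z).
by rewrite -subzn 1?ltnW //; ring.
Qed.

(** Since p is odd, r and p - r have opposite parities and the same square modulo p. The endpoint r
    = p serves the zero class with odd parity. *)
Lemma sqr_mod_parity (p : nat) (c : int) (q : bool) : odd p ->
  exists2 r : nat, (r <= p)%N /\ odd r = q & (c ^+ 2 = r%:Z ^+ 2 %[mod p])%Z.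
Proof.
move=> p_odd; have p0 : p%:Z != 0 by lia.
have [r cr rp] : exists2 r : nat, (c %% p%:Z)%Z = r & (r < p)%N.
  by exists `|c %% p%:Z|%Z%N; have := modz_ge0 c p0; have := ltz_mod c p0; lia.
have e : (c ^+ 2 = r%:Z ^+ 2 %[mod p])%Z by rewrite -cr modzXm.
have [rq|rq] := eqVneq (odd r) q; first by exists r => //; lia.
exists (p - r)%N; first by split; move: rq; case: q; lia.
rewrite e; apply/eqz_modP; exists (2 * r%:Z - p%:Z).
by rewrite -subzn 1?ltnW //; ring.
Qed.

Lemma ltz_mul_norm (p : nat) (k c : int) : (0 < p)%N ->
  `|k * p%:Z| < c * p%:Z -> `|k| < c.
Proof. by move=> p0; rewrite normrM ltr_pM2r // ltz_nat. Qed.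

Lemma sqr_mod_inj (p r s : nat) : prime p -> (r + s < p)%N ->
  (r%:Z ^+ 2 = s%:Z ^+ 2 %[mod p])%Z -> r = s.
Proof.
move=> p_prime rs; have p0 := prime_gt0 p_prime.
move=> /(eqz_mod_sqr _ _ p_prime)[] /eqz_modP[k e].
  have kp : k * p%:Z = r%:Z - s%:Z by rewrite e; ring.
  have : `|k| < 1 by apply: (ltz_mul_norm p0); rewrite kp mul1r; lia.
  by move=> k1; have k0 : k = 0; [lia | move: kp; rewrite k0; lia].
have kp : k * p%:Z = r%:Z + s%:Z by rewrite e; ring.
have : `|k| < 1 by apply: (ltz_mul_norm p0); rewrite kp mul1r; lia.
by move=> k1; have k0 : k = 0; [lia | move: kp; rewrite k0; lia].
Qed.

(** Both r - s and r + s are even, so whichever is divisible by p is an even multiple of p; the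
    bounds leave r - s = 0, r + s = 0 or r + s = 2p, the last forcing r = s = p. *)
Lemma sqr_mod_parity_inj (p r s : nat) : prime p -> odd p ->
  (r <= p)%N -> (s <= p)%N -> odd r = odd s ->
  (r%:Z ^+ 2 = s%:Z ^+ 2 %[mod p])%Z -> r = s.
Proof.
move=> p_prime p_odd rp sp rs; have p0 := prime_gt0 p_prime.
move=> /(eqz_mod_sqr _ _ p_prime)[] /eqz_modP[k e].
  have kp : k * p%:Z = r%:Z - s%:Z by rewrite e; ring.
  have k2 : `|k| < 2 by apply: (ltz_mul_norm p0); rewrite kp; lia.
  have [k0|[k1|k1]] : k = 0 \/ k = 1 \/ k = -1 by lia.
  - by move: kp; rewrite k0; lia.
  - by move: kp; rewrite k1; lia.
  - by move: kp; rewrite k1; lia.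
have kp : k * p%:Z = r%:Z + s%:Z by rewrite e; ring.
have k3 : `|k| < 3 by apply: (ltz_mul_norm p0); rewrite kp; lia.
have k_ge0 : 0 <= k by rewrite -(pmulr_lge0 _ (_ : 0 < p%:Z)) ?kp //; lia.
have [k0|[k1|k2]] : k = 0 \/ k = 1 \/ k = 2 by lia.
- by move: kp; rewrite k0; lia.
- by move: kp; rewrite k1; lia.
- by move: kp; rewrite k2; lia.
Qed.

(** * Reduced representatives and their minimality *)

Lemma Qd_square (d : nat) (x y : int) : (0 < d)%N ->
  4 * Qd d x y = (2 * x + y) ^+ 2 + (ell d)%:Z * y ^+ 2.
Proof.
move=> d0; have -> : (ell d)%:Z = 4 * d%:Z - 1 by rewrite /ell; lia.
by rewrite /Qd; ring.
Qed.

(* The first coordinate of the reduced representative (x, y) of a class,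
   indexed by t so that 2x + y = 2t + odd y. *)
Definition reduced_fst (t y : nat) : int := t%:Z - (y./2)%:Z.

Lemma reduced_fstE (t y : nat) : 2 * reduced_fst t y + y%:Z = (2 * t + odd y)%N.
Proof. by rewrite /reduced_fst; lia. Qed.

Lemma reduced_exists (p : nat) (a b : int) : odd p ->
  exists t y : nat, [/\ (t <= p./2)%N, (y <= p./2)%N,
    ((2 * a + b) ^+ 2 = (2 * reduced_fst t y + y%:Z) ^+ 2 %[mod p])%Z &
    (b ^+ 2 = y%:Z ^+ 2 %[mod p])%Z].
Proof.
move=> p_odd; have [y yh yb] := sqr_mod_half b p_odd.
(* As 2x + y has the parity of y, so must s; then t is the integer half of s. *)
have [s [sp sy] sa] := sqr_mod_parity (2 * a + b) (odd y) p_odd.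
exists s./2, y; split; [exact: half_leq | exact: yh | | exact: yb].
have -> : 2 * reduced_fst s./2 y + y%:Z = s%:Z 
  by rewrite reduced_fstE -sy addnC mul2n odd_double_half.
exact: sa.
Qed.

Lemma reduced_minimal (d p t y t' y' : nat) (u v : int) :
  (0 < d)%N -> prime p -> odd p -> (p ^ 2 < ell d)%N ->
  (t <= p./2)%N -> (y <= p./2)%N -> (t' <= p./2)%N -> (y' <= p./2)%N ->
  ((2 * u + v) ^+ 2 = (2 * reduced_fst t' y' + y'%:Z) ^+ 2 %[mod p])%Z ->
  (v ^+ 2 = y'%:Z ^+ 2 %[mod p])%Z ->
  Qd d u v = Qd d (reduced_fst t y) y%:Z ->
  (y' < y)%N \/ (t' = t /\ y' = y).
Proof.
move=> d0 p_prime p_odd pl th yh t'h y'h.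
rewrite !reduced_fstE => uS vy' Quv.
have sqr_abs (x : int) : x ^+ 2 = (absz x)%:Z ^+ 2.
  by rewrite abszE real_normK ?num_real.
have : 4 * Qd d u v = 4 * Qd d (reduced_fst t y) y%:Z by rewrite Quv.
rewrite !Qd_square // reduced_fstE.
move: uS vy'; rewrite (sqr_abs (2 * u + v)) (sqr_abs v).
move: (absz (2 * u + v)) (absz v) => W w.
set S' := (2 * t' + odd y')%N; set S := (2 * t + odd y)%N => WS wy' Q.
have Qn : (W ^ 2 + ell d * w ^ 2 = S ^ 2 + ell d * y ^ 2)%N.
  by clear -Q; lia.
have [S_le S'_le] : (S <= p)%N /\ (S' <= p)%N.
  by clear -th t'h p_odd; rewrite /S /S'; lia.
(* If w > y, then ell w^2 >= ell y^2 + ell > ell y^2 + p^2 >= ell y^2 + S^2, contradicting [Qn]. *)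
have wy_le : (w <= y)%N.
  rewrite leqNgt; apply/negP => yw.
  have S2 : (S ^ 2 <= p ^ 2)%N by rewrite leq_exp2r.
  have w2 : (y ^ 2 + 1 <= w ^ 2)%N by clear -yw; nia.
  have := leq_mul (leqnn (ell d)) w2.
  by clear -pl S2 Qn; lia.
(* With this bound, w < y gives w = y' by [sqr_mod_inj], hence y' < y. *)
have wy'_lt : (w < y -> w + y' < p)%N by clear -yh y'h; lia.
move: wy_le; rewrite leq_eqVlt => /orP[/eqP wy|wy]; last first.
  by left; rewrite -(sqr_mod_inj p_prime (wy'_lt wy) wy').
right; have y'y : y' = y.
  apply/esym; rewrite -wy; apply: sqr_mod_inj p_prime _ wy'.
  by clear -wy yh y'h p_odd; lia.
have WS_eq : W = S.
  by apply/eqP; rewrite -eqn_sqr; move: Qn; rewrite wy => /addIn ->.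
have odd_S : odd S = odd S' by clear -y'y; rewrite /S /S' y'y; lia.
rewrite WS_eq in WS.
have := sqr_mod_parity_inj p_prime p_odd S_le S'_le odd_S WS.
by clear -y'y; rewrite /S /S' y'y; lia.
Qed.

(** * Dimension of the span and classification of equal series *)

Theorem theorem4 (d p : nat) (d_gt0 : (0 < d)%N)
    (ell_squarefree : squarefree (ell d))
    (p_prime : prime p) (p_odd : odd p) (d_large : (3 * p ^ 2 < d)%N) :
  has_dim
    (linear_span
       [set f : fps rat |
         exists a b : int, f = fps_rat (theta (Lambda d p a b))])
    ((p + 1) ^ 2 %/ 4)%N
  /\
  (forall a b m n : int,
     theta (Lambda d p m n) = theta (Lambda d p a b) <->
     [\/ (m = a %[mod p])%Z /\ (n = b %[mod p])%Z,
         (m = - a - b %[mod p])%Z /\ (n = b %[mod p])%Z,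
         (m = - a %[mod p])%Z /\ (n = - b %[mod p])%Z |
         (m = a + b %[mod p])%Z /\ (n = - b %[mod p])%Z]).
Proof.
have p_gt0 := prime_gt0 p_prime.
have p2_ell : (p ^ 2 < ell d)%N by rewrite /ell; lia.
pose theta_red t y := theta (Lambda d p (reduced_fst t y) y%:Z).
pose exponent t y := `|Qd d (reduced_fst t y) y%:Z|%N.
have exponentE t y : (exponent t y)%:Z = Qd d (reduced_fst t y) y%:Z.
  by rewrite /exponent; have [] := Qd_ge (reduced_fst t y) y%:Z d_gt0; nia.
have theta_red_neq0 t y : theta_red t y (exponent t y) <> 0.
  apply/theta_neq0P => //; exists (reduced_fst t y), y%:Z.
  by rewrite exponentE.
have theta_red_min t y t' y' : (t <= p./2)%N -> (y <= p./2)%N ->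
    (t' <= p./2)%N -> (y' <= p./2)%N ->
    theta_red t' y' (exponent t y) <> 0 ->
    (y' < y)%N \/ (t' = t /\ y' = y).
  move=> th yh t'h y'h /theta_neq0P[]// u [v [ut' vy' Quv]].
  have [uS vS] : ((2 * u + v) ^+ 2 = (2 * reduced_fst t' y' + y'%:Z) ^+ 2
      %[mod p])%Z /\ (v ^+ 2 = y'%:Z ^+ 2 %[mod p])%Z.
    by apply/symmetry_classP => //; apply: Or41.
  apply: (reduced_minimal d_gt0 p_prime p_odd p2_ell th yh t'h y'h uS vS).
  by rewrite -exponentE.
have theta_reduced a b : exists t y : nat, [/\ (t <= p./2)%N, (y <= p./2)%N,
    ((2 * a + b) ^+ 2 = (2 * reduced_fst t y + y%:Z) ^+ 2 %[mod p])%Z /\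
    (b ^+ 2 = y%:Z ^+ 2 %[mod p])%Z &
    theta (Lambda d p a b) = theta_red t y].
  have [t [y [th yh abS bS]]] := reduced_exists a b p_odd.
  exists t, y; split=> //; apply: theta_symmetry => //.
  exact/symmetry_classP.
split; last first.
  move=> a b m n; split; last exact: theta_symmetry.
  have [t [y [th yh [abS bS] ->]]] := theta_reduced a b.
  have [t' [y' [t'h y'h [mnS nS] ->]]] := theta_reduced m n.
  move=> theta_eq; apply/symmetry_classP => //.
  suff [tt yy] : t' = t /\ y' = y by rewrite mnS nS abS bS tt yy.
  (* Equal series are nonzero at both exponents, so minimality applies in both directions; y' < y
     and y < y' cannot both hold. *)
  have := @theta_red_neq0 t' y'; rewrite {1}theta_eq => /theta_red_min.
  have := @theta_red_neq0 t y; rewrite -{1}theta_eq => /theta_red_min.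
  by move=> /(_ th yh t'h y'h) h1 /(_ t'h y'h th yh) h2; clear -h1 h2; lia.
(* This is (p + 1)/2, the number of values of each of t and y. *)
pose h1 := p./2.+1.
have -> : ((p + 1) ^ 2 %/ 4 = h1 * h1)%N.
  have -> : (p + 1 = h1 * 2)%N by rewrite /h1; lia.
  by rewrite expnMn mulnK // mulnn.
(* The index is i = y * h1 + t, with y as leading digit, so that increasing i orders the classes by
   y. *)
pose e (i : 'I_(h1 * h1)) : fps rat := fps_rat (theta_red (i %% h1)%N (i %/ h1)%N).
have fst_le (i : 'I_(h1 * h1)) : (i %% h1 <= p./2)%N by rewrite -ltnS ltn_pmod.
have snd_le (i : 'I_(h1 * h1)) : (i %/ h1 <= p./2)%N.
  by rewrite -ltnS ltn_divLR.
exists e; split.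
  apply: (@triangular_independent rat _ e
    (fun i => exponent (i %% h1)%N (i %/ h1)%N)).
    by move=> i; rewrite /e /fps_rat intr_eq0; apply/eqP.
  move=> i j ij; apply/eqP; rewrite /e /fps_rat intr_eq0; apply/eqP.
  apply: contrapT => /(theta_red_min _ _ _ _ (fst_le i) (snd_le i) (fst_le j)
    (snd_le j)) [|[eq1 eq2]].
    by rewrite ltnNge leq_div2r // ltnW.
  by move: ij; rewrite (divn_eq i h1) (divn_eq j h1) eq1 eq2 ltnn.
(* The generating sets themselves coincide, since every class has a reduced representative. *)
congr linear_span; apply/seteqP; split=> f /=.
  by move=> [i _ <-]; exists (reduced_fst (i %% h1) (i %/ h1)), (i %/ h1)%N.
move=> [a [b ->]]; have [t [y [th yh _ ->]]] := theta_reduced a b.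
have lt_ty : (y * h1 + t < h1 * h1)%N by rewrite /h1 in th yh *; nia.
exists (Ordinal lt_ty) => //; rewrite /e /=.
by rewrite modnMDl divnMDl // modn_small // divn_small // addn0.
Qed.
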